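(* Let $(e):0\to(\mathfrak a,\mathfrak b,\sigma)\to(\mathfrak h,\mathfrak p,\sigma)\xrightarrow{\varphi=(\varphi_1,\varphi_2)}(\mathfrak n,\mathfrak q,\delta)\to0$ be a central extension of Leibniz crossed modules. (i) The following statements are equivalent: (a) $(e)$ is a stem extension of $(\mathfrak n,\mathfrak q,\delta)$; (b) the homomorphism $\theta_*(e):\mathcal M(\mathfrak n,\mathfrak q,\delta)\to(\mathfrak a,\mathfrak b,\sigma)$ is surjective; (c) the homomorphism $(\mathfrak a,\mathfrak b,\sigma)\to(\mathfrak h,\mathfrak p,\sigma)/[(\mathfrak h,\mathfrak p,\sigma),(\mathfrak h,\mathfrak p,\sigma)]$ is the zero map; (d) the homomorphism $\dfrac{(\mathfrak h,\mathfrak p,\sigma)}{[(\mathfrak h,\mathfrak p,\sigma),(\mathfrak h,\mathfrak p,\sigma)]}\to\dfrac{(\mathfrak n,\mathfrak q,\delta)}{[(\mathfrak n,\mathfrak q,\delta),(\mathfrak n,\mathfrak q,\delta)]}$ induced by $\varphi$ is an isomorphism. (ii) If $\mathcal M(\mathfrak n,\mathfrak q,\delta)$ is finite dimensional, then the following statements are equivalent: (a) $(e)$ is a stem cover; (b) $\theta_*(e)$ is an isomorphism; (c) the homomorphism $\dfrac{(\mathfrak h,\mathfrak p,\sigma)}{[(\mathfrak h,\mathfrak p,\sigma),(\mathfrak h,\mathfrak p,\sigma)]}\to\dfrac{(\mathfrak n,\mathfrak q,\delta)}{[(\mathfrak n,\mathfrak q,\delta),(\mathfrak n,\mathfrak q,\delta)]}$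 is an isomorphism and the induced homomorphism $\mathcal M(\mathfrak h,\mathfrak p,\sigma)\to\mathcal M(\mathfrak n,\mathfrak q,\delta)$ is the zero map.
   Context: Fix a field $\mathbb K$. A Leibniz algebra is a $\mathbb K$-vector space $\mathfrak q$ with a bilinear bracket satisfying $[x,[y,z]]=[[x,y],z]-[[x,z],y]$. A Leibniz action of $\mathfrak m$ on $\mathfrak n$ is a pair of bilinear maps $(m,n)\mapsto{}^{m}n$, $(n,m)\mapsto n^{m}$ with values in $\mathfrak n$ such that ${}^{[m,m']}n={}^{m}({}^{m'}n)+({}^{m}n)^{m'}$, ${}^{m}[n,n']=[{}^{m}n,n']-[{}^{m}n',n]$, $n^{[m,m']}=(n^{m})^{m'}-(n^{m'})^{m}$, $[n,n']^{m}=[n^{m},n']+[n,n'^{m}]$, ${}^{m}({}^{m'}n)=-{}^{m}(n^{m'})$, $[n,{}^{m}n']=-[n,n'^{m}]$. A Leibniz crossed module $(\mathfrak n,\mathfrak q,\delta)$ is a homomorphism $\delta:\mathfrak n\to\mathfrak q$ of Leibniz algebras with a Leibniz action of $\mathfrak q$ on $\mathfrak n$ such that $\delta({}^{q}n)=[q,\delta(n)]$, $\delta(n^{q})=[\delta(n),q]$, ${}^{\delta(n_1)}n_2=[n_1,n_2]=n_1^{\delta(n_2)}$. A homomorphism $(\varphi,\psi):(\mathfrak n,\mathfrak q,\delta)\to(\mathfrak n',\mathfrak q',\delta')$ is a pair of Leibniz homomorphisms with $\psi\delta=\delta'\varphi$, $\varphi({}^{q}n)={}^{\psi(q)}\varphi(n)$,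 $\varphi(n^{q})=\varphi(n)^{\psi(q)}$. The category is $\mathbf{XLb}$; kernels, quotients, intersections, inclusions, surjectivity and exactness are componentwise. $(\mathfrak n,\mathfrak q,\delta)$ is finite dimensional if $\mathfrak n$ and $\mathfrak q$ are. Crossed ideals are normal subobjects, i.e. kernels of homomorphisms. Commutators: for crossed ideals $(\mathfrak s,\mathfrak h,\delta)$, $(\mathfrak t,\mathfrak j,\delta)$ of $(\mathfrak n,\mathfrak q,\delta)$, $[(\mathfrak s,\mathfrak h,\delta),(\mathfrak t,\mathfrak j,\delta)]=(\langle D_{\mathfrak h}(\mathfrak t),D_{\mathfrak j}(\mathfrak s)\rangle,[\mathfrak h,\mathfrak j],\delta|)$, where $D_{\mathfrak h}(\mathfrak t)=\{{}^{h}t,t^{h}\mid h\in\mathfrak h,t\in\mathfrak t\}$, similarly $D_{\mathfrak j}(\mathfrak s)$, and $[\mathfrak h,\mathfrak j]$ is generated by all $[x,y],[y,x]$, $x\in\mathfrak h,y\in\mathfrak j$. An extension (short exact sequence) $0\to(\mathfrak a,\mathfrak b,\sigma)\to(\mathfrak h,\mathfrak p,\sigma)\to(\mathfrak n,\mathfrak q,\delta)\to0$ is central if $[(\mathfrak a,\mathfrak b,\sigma),(\mathfrak h,\mathfrak p,\sigma)]=0$. A central extension is a stem extension if $(\mathfrak a,\mathfrak b,\sigma)\subseteq[(\mathfrak h,\mathfrak p,\sigma),(\mathfrak h,\mathfrak p,\sigma)]$; a stem extension is a stem cover if moreover $(\mathfrak a,\mathfrak b,\sigma)\cong\mathcal M(\mathfrak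 n,\mathfrak q,\delta)$. Schur multiplier: $\mathbf{XLb}$ has enough projectives (with respect to surjective homomorphisms). For a projective presentation $0\to(\mathfrak u,\mathfrak r,\mu)\to(\mathfrak m,\mathfrak f,\mu)\to(\mathfrak n,\mathfrak q,\delta)\to0$ (middle term projective), $\mathcal M(\mathfrak n,\mathfrak q,\delta)=\dfrac{(\mathfrak u,\mathfrak r,\mu)\cap[(\mathfrak m,\mathfrak f,\mu),(\mathfrak m,\mathfrak f,\mu)]}{[(\mathfrak u,\mathfrak r,\mu),(\mathfrak m,\mathfrak f,\mu)]}$; it is independent of the presentation and functorial. For a central extension $(e)$, the homomorphism $\theta_*(e)$ is induced by lifting $(\mathfrak m,\mathfrak f,\mu)\to(\mathfrak n,\mathfrak q,\delta)$ to $(\mathfrak m,\mathfrak f,\mu)\to(\mathfrak h,\mathfrak p,\sigma)$ and restricting to $(\mathfrak u,\mathfrak r,\mu)\to(\mathfrak a,\mathfrak b,\sigma)$; this restriction kills $[(\mathfrak u,\mathfrak r,\mu),(\mathfrak m,\mathfrak f,\mu)]$. *)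

(* Defs.v *)
From HB Require Import structures.
From mathcomp Require Import all_boot all_order all_algebra.
From mathcomp Require Import generic_quotient ring_quotient boolp.

Set Implicit Arguments.
Unset Strict Implicit.
Unset Printing Implicit Defensive.

Import GRing.Theory.
Local Open Scope ring_scope.

Section LinearAlgebra.
Variable K : fieldType.

Section Linear.
Variables (V W : lmodType K) (f : V -> W) (lin_f : linear f).
Definition lin_fun : V -> W := f.
HB.instance Definition _ := GRing.isLinear.Build K V W *:%R lin_fun lin_f.
Definition linear_of : {linear V -> W} := lin_fun.
Lemma linear_ofE x : linear_of x = f x. Proof. by []. Qed.
End Linear.

Section Subspaces.
Variables (V : lmodType K) (P : V -> Prop) (P0 : P 0)
  (PL : forall (a : K) x y, P x -> P y -> P (a *: x + y)).
Definition prop_pred : {pred V} := [pred x | `[< P x >]].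
Fact prop_pred_submod : submod_closed prop_pred.
Proof.
split=> [|a x y]; first exact/asboolP.
by move=> /asboolP Px /asboolP Py; apply/asboolP/PL.
Qed.
HB.instance Definition _ := GRing.isSubmodClosed.Build K V prop_pred prop_pred_submod.
Definition subspace_of : submodClosed V := prop_pred.
Lemma subspace_ofP x : reflect (P x) (x \in subspace_of).
Proof. exact: asboolP. Qed.
End Subspaces.

Section SubType.
Variables (V : lmodType K) (S : submodClosed V).
Record sub_of := SubOf { sub_val : V; sub_valP : sub_val \in S }.
HB.instance Definition _ := [isSub for sub_val].
HB.instance Definition _ := [Choice of sub_of by <:].
HB.instance Definition _ := [SubChoice_isSubLmodule of sub_of by <:].
Fact sub_val_linear : linear sub_val.
Proof. by []. Qed.
Lemma sub_eq (x y : sub_of) : sub_val x = sub_val y -> x = y.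
Proof. exact: val_inj. Qed.
End SubType.

Section QuoType.
Variables (V : lmodType K) (S : submodClosed V).
Local Open Scope quotient_scope.

(* [submodClosed] is stated over semirings and does not record the closure     *)
(* under opposite that the library's quotient of Z-modules requires.          *)
Definition zmod_pred : {pred V} := [pred x | x \in S].
Fact zmod_pred_closed : zmod_closed zmod_pred.
Proof. exact: (GRing.subsemimod_closedB (GRing.submodClosedP S)). Qed.
HB.instance Definition _ := GRing.isZmodClosed.Build V zmod_pred zmod_pred_closed.
Definition zmod_of : zmodClosed V := zmod_pred.

Definition quo_of := Quotient.quot zmod_of.
HB.instance Definition _ := GRing.Zmodule.on quo_of.
Definition quo_pi (x : V) : quo_of := \pi_(Quotient.quot zmod_of) x.
Definition quo_repr (u : quo_of) : V := repr u.

Lemma quo_reprK u : quo_pi (quo_repr u) = u.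
Proof. exact: reprK. Qed.

Lemma quo_eq x y : (quo_pi x = quo_pi y) <-> (x - y \in S).
Proof.
have -> : (x - y \in S) = (x - y \in zmod_of) by [].
by rewrite Quotient.idealrBE; split=> /eqP.
Qed.

Lemma quo_repr_pi x : quo_repr (quo_pi x) - x \in S.
Proof. by apply/quo_eq; rewrite quo_reprK. Qed.

Lemma quo_piD x y : quo_pi (x + y) = quo_pi x + quo_pi y.
Proof. exact: raddfD. Qed.

Definition quo_scale (a : K) (u : quo_of) : quo_of := quo_pi (a *: quo_repr u).

Lemma quo_scale_pi a x : quo_scale a (quo_pi x) = quo_pi (a *: x).
Proof. by apply/quo_eq; rewrite -scalerBr rpredZ ?quo_repr_pi. Qed.

Fact quo_scaleA a b u : quo_scale a (quo_scale b u) = quo_scale (a * b) u.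
Proof. by rewrite -[u]quo_reprK !quo_scale_pi scalerA. Qed.
Fact quo_scale1 : left_id 1 quo_scale.
Proof. by move=> u; rewrite -[u]quo_reprK quo_scale_pi scale1r. Qed.
Fact quo_scaleDr : right_distributive quo_scale +%R.
Proof.
move=> a u v; rewrite -[u]quo_reprK -[v]quo_reprK -quo_piD !quo_scale_pi.
by rewrite scalerDr quo_piD.
Qed.
Fact quo_scaleDl u : {morph quo_scale^~ u : a b / a + b}.
Proof.
by move=> a b; rewrite -[u]quo_reprK !quo_scale_pi scalerDl quo_piD.
Qed.
HB.instance Definition _ := GRing.Zmodule_isLmodule.Build K quo_of
  quo_scaleA quo_scale1 quo_scaleDr quo_scaleDl.

Fact quo_pi_linear : linear quo_pi.
Proof. by move=> a x y; rewrite quo_piD -quo_scale_pi. Qed.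
HB.instance Definition _ :=
  GRing.isLinear.Build K V quo_of *:%R quo_pi quo_pi_linear.

Lemma quo_pi0 x : (quo_pi x = 0) <-> (x \in S).
Proof. by rewrite -(raddf0 quo_pi) quo_eq subr0. Qed.
End QuoType.

Inductive span (V : lmodType K) (G : V -> Prop) : V -> Prop :=
| span_gen x of G x : span G x
| span_zero : span G 0
| span_lin (a : K) x y of span G x & span G y : span G (a *: x + y).

Definition span_of (V : lmodType K) (G : V -> Prop) : submodClosed V :=
  subspace_of (span_zero G) (@span_lin V G).

Lemma span_of_min (V W : lmodType K) (G : V -> Prop) (f : {linear V -> W})
    (S : submodClosed W) :
  (forall x, G x -> f x \in S) -> forall x, x \in span_of G -> f x \in S.
Proof.
move=> GS x /subspace_ofP; elim=> {x} [x /GS //||a x y _ Sx _ Sy].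
  by rewrite raddf0 rpred0.
by rewrite linearP rpredD ?rpredZ.
Qed.

Lemma mem_span_of (V : lmodType K) (G : V -> Prop) x : G x -> x \in span_of G.
Proof. by move=> Gx; apply/subspace_ofP/span_gen. Qed.

Definition finite_dimensional (V : lmodType K) : Prop :=
  exists n (b : 'I_n -> V), forall v, exists c : 'I_n -> K,
    v = \sum_(i < n) c i *: b i.

End LinearAlgebra.

Section CrossedModules.
Variable K : fieldType.

Record leibniz := Leibniz {
  lb_sort :> lmodType K;
  lb : lb_sort -> lb_sort -> lb_sort;
  lb_linl : forall y, linear (lb^~ y);
  lb_linr : forall x, linear (lb x);
  lb_leibniz : forall x y z, lb x (lb y z) = lb (lb x y) z - lb (lb x z) y }.

Definition leibniz_hom (p q : leibniz) (f : p -> q) : Prop :=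
  forall x y, f (lb x y) = lb (f x) (f y).

(* [al x n] is the left action ^x n, and [ar n x] the right action n^x. *)
Record leibniz_action (m n : leibniz) (al : m -> n -> n) (ar : n -> m -> n) :
    Prop := LeibnizAction {
  al_linl : forall u, linear (al^~ u);
  al_linr : forall x, linear (al x);
  ar_linl : forall x, linear (ar^~ x);
  ar_linr : forall u, linear (ar u);
  al_lb : forall x y u, al (lb x y) u = al x (al y u) + ar (al x u) y;
  lb_al : forall x u v, al x (lb u v) = lb (al x u) v - lb (al x v) u;
  ar_lb : forall u x y, ar u (lb x y) = ar (ar u x) y - ar (ar u y) x;
  lb_ar : forall u v x, ar (lb u v) x = lb (ar u x) v + lb u (ar v x);
  al_al : forall x y u, al x (al y u) = - al x (ar u y);
  lb_al_ar : forall u x v, lb u (al x v) = - lb u (ar v x) }.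

Record xmod := XMod {
  xn : leibniz;
  xq : leibniz;
  xd : {linear xn -> xq};
  xal : xq -> xn -> xn;
  xar : xn -> xq -> xn;
  xd_hom : leibniz_hom xd;
  x_act : leibniz_action xal xar;
  xd_al : forall y u, xd (xal y u) = lb y (xd u);
  xd_ar : forall u y, xd (xar u y) = lb (xd u) y;
  xal_d : forall u v, xal (xd u) v = lb u v;
  xar_d : forall u v, xar u (xd v) = lb u v }.

Record xhom (X Y : xmod) := XHom {
  hn : {linear xn X -> xn Y};
  hq : {linear xq X -> xq Y};
  hn_hom : leibniz_hom hn;
  hq_hom : leibniz_hom hq;
  hd : forall u, hq (xd X u) = xd Y (hn u);
  hal : forall y u, hn (xal y u) = xal (hq y) (hn u);
  har : forall u y, hn (xar u y) = xar (hn u) (hq y) }.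

Definition surjective_hom X Y (f : xhom X Y) : Prop :=
  (forall v, exists u, hn f u = v) /\ (forall y, exists x, hq f x = y).

Definition zero_hom X Y (f : xhom X Y) : Prop :=
  (forall u, hn f u = 0) /\ (forall x, hq f x = 0).

Definition injective_hom X Y (f : xhom X Y) : Prop :=
  injective (hn f) /\ injective (hq f).

Definition isomorphism X Y (f : xhom X Y) : Prop :=
  exists g : xhom Y X, [/\ cancel (hn f) (hn g), cancel (hn g) (hn f),
                           cancel (hq f) (hq g) & cancel (hq g) (hq f)].

Definition isomorphic X Y : Prop := exists f : xhom X Y, isomorphism f.

Definition finite_dimensional_xmod (X : xmod) : Prop :=
  finite_dimensional (xn X) /\ finite_dimensional (xq X).

Definition eq_hom X Y (f g : xhom X Y) : Prop :=
  hn f =1 hn g /\ hq f =1 hq g.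

#[local] Obligation Tactic := idtac.

Program Definition hom_comp X Y Z (g : xhom Y Z) (f : xhom X Y) : xhom X Z :=
  @XHom X Z (hn g \o hn f) (hq g \o hq f) _ _ _ _ _.
Next Obligation. by move=> X Y Z g f u v; rewrite /= !hn_hom. Qed.
Next Obligation. by move=> X Y Z g f u v; rewrite /= !hq_hom. Qed.
Next Obligation. by move=> X Y Z g f u; rewrite /= !hd. Qed.
Next Obligation. by move=> X Y Z g f y u; rewrite /= !hal. Qed.
Next Obligation. by move=> X Y Z g f u y; rewrite /= !har. Qed.

Definition projective (P : xmod) : Prop :=
  forall (Y Z : xmod) (g : xhom Y Z) (f : xhom P Z), surjective_hom g ->
    exists f' : xhom P Y, eq_hom (hom_comp g f') f.


(* The two components of a crossed ideal, in elementwise form; by             *)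
(* [crossed_idealP] these are exactly the kernels of homomorphisms.           *)
Record crossed_ideal (X : xmod) := CrossedIdeal {
  cn : submodClosed (xn X);
  cq : submodClosed (xq X);
  cd : forall u, u \in cn -> xd X u \in cq;
  cq_lbl : forall x y, x \in cq -> lb x y \in cq;
  cq_lbr : forall x y, y \in cq -> lb x y \in cq;
  cn_al : forall y u, u \in cn -> xal y u \in cn;
  cn_ar : forall y u, u \in cn -> xar u y \in cn;
  cq_al : forall y u, y \in cq -> xal y u \in cn;
  cq_ar : forall y u, y \in cq -> xar u y \in cn }.

Lemma cn_lbl X (I : crossed_ideal X) u v : u \in cn I -> lb u v \in cn I.
Proof. by move=> Iu; rewrite -xar_d cn_ar. Qed.
Lemma cn_lbr X (I : crossed_ideal X) u v : v \in cn I -> lb u v \in cn I.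
Proof. by move=> Iv; rewrite -xal_d cn_al. Qed.

Definition ideal_sub X (I J : crossed_ideal X) : Prop :=
  (forall u, u \in cn I -> u \in cn J) /\ (forall x, x \in cq I -> x \in cq J).

Definition ideal_trivial X (I : crossed_ideal X) : Prop :=
  (forall u, u \in cn I -> u = 0) /\ (forall x, x \in cq I -> x = 0).

Lemma lin0 (V W : lmodType K) (f : V -> W) : linear f -> f 0 = 0.
Proof. by move=> lf; rewrite -[f]/(linear_of lf : V -> W) raddf0. Qed.
Lemma linB (V W : lmodType K) (f : V -> W) : linear f ->
  forall x y, f (x - y) = f x - f y.
Proof. by move=> lf x y; rewrite -[f]/(linear_of lf : V -> W) raddfB. Qed.

Section Objects.
Variable X : xmod.

Program Definition full_ideal : crossed_ideal X :=
  @CrossedIdeal X (@subspace_of K (xn X) (fun=> True) I (fun _ _ _ _ _ => I))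
    (@subspace_of K (xq X) (fun=> True) I (fun _ _ _ _ _ => I))
    _ _ _ _ _ _ _.
Solve All Obligations with by move=> *; apply/subspace_ofP.

Program Definition ideal_cap (I J : crossed_ideal X) : crossed_ideal X :=
  @CrossedIdeal X
    (@subspace_of K (xn X) (fun u => u \in cn I /\ u \in cn J) _ _)
    (@subspace_of K (xq X) (fun x => x \in cq I /\ x \in cq J) _ _)
    _ _ _ _ _ _ _.
Next Obligation. by move=> I J; split; exact: rpred0. Qed.
Next Obligation.
by move=> I J a x y [? ?] [? ?]; split; rewrite /= rpredD ?rpredZ.
Qed.
Next Obligation. by move=> I J; split; exact: rpred0. Qed.
Next Obligation.
by move=> I J a x y [? ?] [? ?]; split; rewrite /= rpredD ?rpredZ.
Qed.
Next Obligation.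
by move=> I J u /subspace_ofP[? ?]; apply/subspace_ofP; split; apply: cd.
Qed.
Next Obligation.
by move=> I J x y /subspace_ofP[? ?]; apply/subspace_ofP; split; apply: cq_lbl.
Qed.
Next Obligation.
by move=> I J x y /subspace_ofP[? ?]; apply/subspace_ofP; split; apply: cq_lbr.
Qed.
Next Obligation.
by move=> I J x y /subspace_ofP[? ?]; apply/subspace_ofP; split; apply: cn_al.
Qed.
Next Obligation.
by move=> I J x y /subspace_ofP[? ?]; apply/subspace_ofP; split; apply: cn_ar.
Qed.
Next Obligation.
by move=> I J x y /subspace_ofP[? ?]; apply/subspace_ofP; split; apply: cq_al.
Qed.
Next Obligation.
by move=> I J x y /subspace_ofP[? ?]; apply/subspace_ofP; split; apply: cq_ar.
Qed.

(* [gen_n I J] is the union of D_h(t) and D_j(s) for I = (s, h), J = (t, j).  *)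
Definition gen_n (I J : crossed_ideal X) (w : xn X) : Prop :=
  (exists h t, [/\ h \in cq I, t \in cn J & w = xal h t \/ w = xar t h]) \/
  (exists j s, [/\ j \in cq J, s \in cn I & w = xal j s \/ w = xar s j]).

Definition gen_q (I J : crossed_ideal X) (z : xq X) : Prop :=
  exists x y, [/\ x \in cq I, y \in cq J & z = lb x y \/ z = lb y x].

Section Commutator.
Variables I J : crossed_ideal X.
Let Sn := span_of (gen_n I J).
Let Sq := span_of (gen_q I J).

Lemma mem_gen_n h t : h \in cq I -> t \in cn J -> (xal h t \in Sn) * (xar t h \in Sn).
Proof.
by split; apply: mem_span_of; left; exists h, t; split=> //; [left|right].
Qed.
Lemma mem_gen_n' j s : j \in cq J -> s \in cn I -> (xal j s \in Sn) * (xar s j \in Sn).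
Proof.
by split; apply: mem_span_of; right; exists j, s; split=> //; [left|right].
Qed.
Lemma mem_gen_q x y : x \in cq I -> y \in cq J -> (lb x y \in Sq) * (lb y x \in Sq).
Proof.
by split; apply: mem_span_of; exists x, y; split=> //; [left|right].
Qed.

Fact comm_d w : w \in Sn -> xd X w \in Sq.
Proof.
apply: span_of_min => {}w.
case=> -[h] [t] [hh ht [] ->]; rewrite ?xd_al ?xd_ar; have dt := cd ht;
  by rewrite ?(mem_gen_q hh dt) ?(mem_gen_q dt hh).
Qed.

Fact comm_lbl z y : z \in Sq -> lb z y \in Sq.
Proof.
apply: (@span_of_min _ _ _ _ (linear_of (lb_linl y))) => {}z [a] [b] [Ia Jb].
have lbE (c d : xq X) : lb (lb c d) y = lb c (lb d y) + lb (lb c y) d.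
  by rewrite lb_leibniz subrK.
by case=> ->; rewrite linear_ofE lbE rpredD ?(mem_gen_q Ia (cq_lbl y Jb))
  ?(mem_gen_q (cq_lbl y Ia) Jb).
Qed.

Fact comm_lbr y z : z \in Sq -> lb y z \in Sq.
Proof.
apply: (@span_of_min _ _ _ _ (linear_of (lb_linr y))) => {}z [a] [b] [Ia Jb].
by case=> ->; rewrite linear_ofE lb_leibniz -scaleN1r
  rpredD ?rpredZ ?(mem_gen_q Ia (cq_lbr y Jb)) ?(mem_gen_q (cq_lbr y Ia) Jb).
Qed.

Let act := x_act X.

Fact comm_al y w : w \in Sn -> xal y w \in Sn.
Proof.
have E h t : xal y (xal h t) = xal (lb y h) t - xar (xal y t) h.
  by rewrite (al_lb act) addrK.
have E' h t : xal y (xar t h) = (-1) *: (xal y (xal h t)).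
  by rewrite (al_al act) scaleN1r opprK.
apply: (@span_of_min _ _ _ _ (linear_of (al_linr act y))) => {}w.
case=> -[h] [t] [hh ht [] ->]; rewrite linear_ofE ?E' ?rpredZ ?E -?scaleN1r;
 by rewrite ?rpredZ// rpredD ?rpredZ //
  ?(mem_gen_n (cq_lbr y hh) ht) ?(mem_gen_n hh (cn_al y ht))
  ?(mem_gen_n' (cq_lbr y hh) ht) ?(mem_gen_n' hh (cn_al y ht)).
Qed.

Fact comm_ar y w : w \in Sn -> xar w y \in Sn.
Proof.
have E h t : xar (xal h t) y = xal (lb h y) t - xal h (xal y t).
  by rewrite (al_lb act) addrC addKr.
have E' h t : xar (xar t h) y = xar t (lb h y) + xar (xar t y) h.
  by rewrite (ar_lb act) subrK.
apply: (@span_of_min _ _ _ _ (linear_of (ar_linl act y))) => {}w.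
case=> -[h] [t] [hh ht [] ->]; rewrite linear_ofE ?E' ?E -?scaleN1r;
 by rewrite rpredD ?rpredZ //
  ?(mem_gen_n (cq_lbl y hh) ht) ?(mem_gen_n hh (cn_al y ht))
  ?(mem_gen_n hh (cn_ar y ht)) ?(mem_gen_n' hh (cn_ar y ht))
  ?(mem_gen_n' (cq_lbl y hh) ht) ?(mem_gen_n' hh (cn_al y ht)).
Qed.

Fact comm_qal z u : z \in Sq -> xal z u \in Sn.
Proof.
apply: (@span_of_min _ _ _ _ (linear_of (al_linl act u))) => {}z [a] [b] [Ia Jb].
by case=> ->; rewrite linear_ofE (al_lb act) rpredD //
  ?(mem_gen_n Ia (cq_al u Jb)) ?(mem_gen_n' Jb (cq_al u Ia)).
Qed.

Fact comm_qar z u : z \in Sq -> xar u z \in Sn.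
Proof.
apply: (@span_of_min _ _ _ _ (linear_of (ar_linr act u))) => {}z [a] [b] [Ia Jb].
by case=> ->; rewrite linear_ofE (ar_lb act) -scaleN1r rpredD ?rpredZ //
  ?(mem_gen_n Ia (cq_ar u Jb)) ?(mem_gen_n' Jb (cq_ar u Ia)).
Qed.

(* The linear spans of the generators already form a crossed ideal, so it is  *)
(* immaterial whether "generated" refers to subspaces, subalgebras or ideals. *)
Definition commutator : crossed_ideal X :=
  @CrossedIdeal X Sn Sq comm_d comm_lbl comm_lbr comm_al comm_ar comm_qal comm_qar.
End Commutator.


Section SubObject.
Variable I : crossed_ideal X.

Program Definition sub_leibniz (L : leibniz) (S : submodClosed L)
    (lbS : forall x y, x \in S -> y \in S -> lb x y \in S) : leibniz :=
  @Leibniz (sub_of S) (fun x y => SubOf (lbS _ _ (sub_valP x) (sub_valP y))) _ _ _.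
Next Obligation. by move=> L S lbS z a x y; apply/sub_eq/lb_linl. Qed.
Next Obligation. by move=> L S lbS z a x y; apply/sub_eq/lb_linr. Qed.
Next Obligation. by move=> L S lbS x y z; apply/sub_eq/lb_leibniz. Qed.

Definition sub_n := @sub_leibniz (xn X) (cn I) (fun x y Ix _ => cn_lbl y Ix).
Definition sub_q := @sub_leibniz (xq X) (cq I) (fun x y Ix _ => cq_lbl y Ix).
Definition sub_d (u : sub_n) : sub_q := SubOf (cd (sub_valP u)).
Definition sub_al (y : sub_q) (u : sub_n) : sub_n := SubOf (cn_al (sub_val y) (sub_valP u)).
Definition sub_ar (u : sub_n) (y : sub_q) : sub_n := SubOf (cn_ar (sub_val y) (sub_valP u)).

Fact sub_d_linear : linear sub_d.
Proof. by move=> a x y; apply/sub_eq/linearP. Qed.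

Fact sub_act : leibniz_action sub_al sub_ar.
Proof.
have act := x_act X; split.
- by move=> u a x y; apply/sub_eq/(al_linl act).
- by move=> u a x y; apply/sub_eq/(al_linr act).
- by move=> u a x y; apply/sub_eq/(ar_linl act).
- by move=> u a x y; apply/sub_eq/(ar_linr act).
- by move=> x y u; apply/sub_eq/(al_lb act).
- by move=> x u v; apply/sub_eq/(lb_al act).
- by move=> u x y; apply/sub_eq/(ar_lb act).
- by move=> u v x; apply/sub_eq/(lb_ar act).
- by move=> x y u; apply/sub_eq/(al_al act).
- by move=> u x v; apply/sub_eq/(lb_al_ar act).
Qed.

Program Definition sub_xmod : xmod :=
  @XMod sub_n sub_q (linear_of sub_d_linear) sub_al sub_ar _ sub_act _ _ _ _.
Next Obligation. by move=> u v; apply/sub_eq/xd_hom. Qed.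
Next Obligation. by move=> y u; apply/sub_eq/xd_al. Qed.
Next Obligation. by move=> u y; apply/sub_eq/xd_ar. Qed.
Next Obligation. by move=> u v; apply/sub_eq/xal_d. Qed.
Next Obligation. by move=> u v; apply/sub_eq/xar_d. Qed.

Program Definition sub_incl : xhom sub_xmod X :=
  @XHom sub_xmod X (linear_of (@sub_val_linear _ _ (cn I)))
    (linear_of (@sub_val_linear _ _ (cq I))) _ _ _ _ _.
Solve All Obligations with by [].
End SubObject.

Section QuoObject.
Variable I : crossed_ideal X.

(* The bracket and the actions of the quotient are computed on chosen         *)
(* representatives; the [quo_*_pi] lemmas state their independence of them.   *)
Section QuoLeibniz.
Variables (L : leibniz) (S : submodClosed L).
Hypotheses (lbS : forall x y, x \in S -> lb x y \in S)
  (lbS' : forall x y, y \in S -> lb x y \in S).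

Definition quo_lb (x y : quo_of S) : quo_of S :=
  quo_pi S (lb (quo_repr x) (quo_repr y)).
Lemma quo_lb_pi x y : quo_lb (quo_pi S x) (quo_pi S y) = quo_pi S (lb x y).
Proof.
apply/quo_eq; set x' := quo_repr _; set y' := quo_repr _.
have -> : lb x' y' - lb x y = lb (x' - x) y' + lb x (y' - y).
  by rewrite (linB (lb_linl _)) (linB (lb_linr _)) addrA subrK.
by apply: rpredD; [apply: lbS|apply: lbS']; apply: quo_repr_pi.
Qed.

Program Definition quo_leibniz : leibniz := @Leibniz (quo_of S) quo_lb _ _ _.
Next Obligation.
move=> z a x y /=; rewrite -[x]quo_reprK -[y]quo_reprK -[z]quo_reprK.
by rewrite -linearP !quo_lb_pi lb_linl linearP.
Qed.
Next Obligation.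
move=> z a x y /=; rewrite -[x]quo_reprK -[y]quo_reprK -[z]quo_reprK.
by rewrite -linearP !quo_lb_pi lb_linr linearP.
Qed.
Next Obligation.
move=> x y z /=; rewrite -[x]quo_reprK -[y]quo_reprK -[z]quo_reprK.
by rewrite !quo_lb_pi lb_leibniz raddfB.
Qed.
End QuoLeibniz.

Definition quo_n := quo_leibniz (@cn_lbl X I) (@cn_lbr X I).
Definition quo_q := quo_leibniz (@cq_lbl X I) (@cq_lbr X I).
Let pn : xn X -> quo_n := quo_pi (cn I).
Let pq : xq X -> quo_q := quo_pi (cq I).
Let rn : quo_n -> xn X := @quo_repr _ _ (cn I).
Let rq : quo_q -> xq X := @quo_repr _ _ (cq I).

Definition quo_d (u : quo_n) : quo_q := pq (xd X (rn u)).
Definition quo_al (y : quo_q) (u : quo_n) : quo_n := pn (xal (rq y) (rn u)).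
Definition quo_ar (u : quo_n) (y : quo_q) : quo_n := pn (xar (rn u) (rq y)).

Let act := x_act X.

Lemma quo_d_pi u : quo_d (pn u) = pq (xd X u).
Proof. by apply/quo_eq; rewrite -raddfB; apply/cd/quo_repr_pi. Qed.
Lemma quo_al_pi y u : quo_al (pq y) (pn u) = pn (xal y u).
Proof.
apply/quo_eq; set y' := rq _; set u' := rn _.
have -> : xal y' u' - xal y u = xal (y' - y) u' + xal y (u' - u).
  by rewrite (linB (al_linl act _)) (linB (al_linr act _)) addrA subrK.
by apply: rpredD; [apply: cq_al|apply: cn_al]; apply: quo_repr_pi.
Qed.
Lemma quo_ar_pi u y : quo_ar (pn u) (pq y) = pn (xar u y).
Proof.
apply/quo_eq; set y' := rq _; set u' := rn _.
have -> : xar u' y' - xar u y = xar u' (y' - y) + xar (u' - u) y.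
  by rewrite (linB (ar_linl act _)) (linB (ar_linr act _)) addrA subrK.
by apply: rpredD; [apply: cq_ar|apply: cn_ar]; apply: quo_repr_pi.
Qed.
Let lbn_pi u v : lb (pn u) (pn v) = pn (lb u v).
Proof. exact: (quo_lb_pi (@cn_lbl X I) (@cn_lbr X I)). Qed.
Let lbq_pi x y : lb (pq x) (pq y) = pq (lb x y).
Proof. exact: (quo_lb_pi (@cq_lbl X I) (@cq_lbr X I)). Qed.
Let pn_lin : linear pn. Proof. exact: linearP. Qed.
Let pq_lin : linear pq. Proof. exact: linearP. Qed.
Let rnK u : pn (rn u) = u. Proof. exact: quo_reprK. Qed.
Let rqK y : pq (rq y) = y. Proof. exact: quo_reprK. Qed.
Let quoE := (lbn_pi, lbq_pi, quo_d_pi, quo_al_pi, quo_ar_pi).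
Let pnD u v : pn (u + v) = pn u + pn v. Proof. exact: raddfD. Qed.
Let pnN u : pn (- u) = - pn u. Proof. exact: raddfN. Qed.

Fact quo_d_linear : linear quo_d.
Proof.
move=> a x y; rewrite -[x]rnK -[y]rnK -pn_lin !quoE.
by rewrite -pq_lin linearP.
Qed.

Fact quo_act : leibniz_action quo_al quo_ar.
Proof.
split.
- move=> u a x y /=; rewrite -[u]rnK -[x]rqK -[y]rqK -pq_lin !quoE.
  by rewrite (al_linl act) pn_lin.
- move=> u a x y /=; rewrite -[u]rqK -[x]rnK -[y]rnK -pn_lin !quoE.
  by rewrite (al_linr act) pn_lin.
- move=> u a x y /=; rewrite -[u]rqK -[x]rnK -[y]rnK -pn_lin !quoE.
  by rewrite (ar_linl act) pn_lin.
- move=> u a x y /=; rewrite -[u]rnK -[x]rqK -[y]rqK -pq_lin !quoE.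
  by rewrite (ar_linr act) pn_lin.
- by move=> x y u; rewrite -[x]rqK -[y]rqK -[u]rnK !quoE (al_lb act) pnD.
- by move=> x u v; rewrite -[x]rqK -[u]rnK -[v]rnK !quoE (lb_al act) pnD pnN.
- by move=> u x y; rewrite -[x]rqK -[y]rqK -[u]rnK !quoE (ar_lb act) pnD pnN.
- by move=> u v x; rewrite -[x]rqK -[u]rnK -[v]rnK !quoE (lb_ar act) pnD.
- by move=> x y u; rewrite -[x]rqK -[y]rqK -[u]rnK !quoE (al_al act) pnN.
- by move=> u x v; rewrite -[x]rqK -[u]rnK -[v]rnK !quoE (lb_al_ar act) pnN.
Qed.

Program Definition quo_xmod : xmod :=
  @XMod quo_n quo_q (linear_of quo_d_linear) quo_al quo_ar _ quo_act _ _ _ _.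
Next Obligation.
by move=> u v; rewrite !linear_ofE -[u]rnK -[v]rnK !quoE xd_hom.
Qed.
Next Obligation.
by move=> y u; rewrite !linear_ofE -[u]rnK -[y]rqK !quoE xd_al.
Qed.
Next Obligation.
by move=> u y; rewrite !linear_ofE -[u]rnK -[y]rqK !quoE xd_ar.
Qed.
Next Obligation.
by move=> u v; rewrite !linear_ofE -[u]rnK -[v]rnK !quoE xal_d.
Qed.
Next Obligation.
by move=> u v; rewrite !linear_ofE -[u]rnK -[v]rnK !quoE xar_d.
Qed.

Program Definition quo_proj : xhom X quo_xmod :=
  @XHom X quo_xmod (linear_of pn_lin) (linear_of pq_lin) _ _ _ _ _.
Next Obligation. by move=> u v; exact: (esym (lbn_pi u v)). Qed.
Next Obligation. by move=> x y; exact: (esym (lbq_pi x y)). Qed.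
Next Obligation. by move=> u; exact: (esym (quo_d_pi u)). Qed.
Next Obligation. by move=> y u; exact: (esym (quo_al_pi y u)). Qed.
Next Obligation. by move=> u y; exact: (esym (quo_ar_pi u y)). Qed.

Lemma quo_projP : (forall u, hn quo_proj u = 0 <-> u \in cn I) /\
                  (forall x, hq quo_proj x = 0 <-> x \in cq I).
Proof. by split=> u; apply: quo_pi0. Qed.
End QuoObject.

End Objects.

Lemma hn0 X Y (f : xhom X Y) : hn f 0 = 0. Proof. exact: raddf0. Qed.
Lemma hq0 X Y (f : xhom X Y) : hq f 0 = 0. Proof. exact: raddf0. Qed.
Lemma hn_lin X Y (f : xhom X Y) : linear (hn f). Proof. exact: linearP. Qed.
Lemma hq_lin X Y (f : xhom X Y) : linear (hq f). Proof. exact: linearP. Qed.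

Program Definition preimage X Y (f : xhom X Y) (J : crossed_ideal Y) :
    crossed_ideal X :=
  @CrossedIdeal X
    (@subspace_of K (xn X) (fun u => hn f u \in cn J) _ _)
    (@subspace_of K (xq X) (fun x => hq f x \in cq J) _ _)
    _ _ _ _ _ _ _.
Next Obligation. by move=> X Y f J; rewrite /= hn0 rpred0. Qed.
Next Obligation.
by move=> X Y f J a u v Ju Jv; rewrite /= hn_lin; apply: rpredD => //; apply: rpredZ.
Qed.
Next Obligation. by move=> X Y f J; rewrite /= hq0 rpred0. Qed.
Next Obligation.
by move=> X Y f J a u v Ju Jv; rewrite /= hq_lin; apply: rpredD => //; apply: rpredZ.
Qed.
Next Obligation.
by move=> X Y f J u /subspace_ofP Ju; apply/subspace_ofP; rewrite hd cd.
Qed.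
Next Obligation.
by move=> X Y f J x y /subspace_ofP Ju; apply/subspace_ofP; rewrite hq_hom cq_lbl.
Qed.
Next Obligation.
by move=> X Y f J x y /subspace_ofP Ju; apply/subspace_ofP; rewrite hq_hom cq_lbr.
Qed.
Next Obligation.
by move=> X Y f J x y /subspace_ofP Ju; apply/subspace_ofP; rewrite hal cn_al.
Qed.
Next Obligation.
by move=> X Y f J x y /subspace_ofP Ju; apply/subspace_ofP; rewrite har cn_ar.
Qed.
Next Obligation.
by move=> X Y f J x y /subspace_ofP Ju; apply/subspace_ofP; rewrite hal cq_al.
Qed.
Next Obligation.
by move=> X Y f J x y /subspace_ofP Ju; apply/subspace_ofP; rewrite har cq_ar.
Qed.

Definition is_kernel X Y (f : xhom X Y) (Pn : xn X -> Prop) (Pq : xq X -> Prop) :=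
  (forall u, hn f u = 0 <-> Pn u) /\ (forall x, hq f x = 0 <-> Pq x).

Section KernelIdeal.
Variables (X Y : xmod) (f : xhom X Y) (Pn : xn X -> Prop) (Pq : xq X -> Prop).
Hypothesis kerf : is_kernel f Pn Pq.
Let fn := kerf.1.
Let fq := kerf.2.
Let act := x_act Y.

Fact ker_n0 : Pn 0. Proof. by apply/fn; rewrite raddf0. Qed.
Fact ker_q0 : Pq 0. Proof. by apply/fq; rewrite raddf0. Qed.
Fact ker_nL (a : K) u v : Pn u -> Pn v -> Pn (a *: u + v).
Proof.
by move=> /fn fu /fn fv; apply/fn; rewrite hn_lin fu fv scaler0 addr0.
Qed.
Fact ker_qL (a : K) u v : Pq u -> Pq v -> Pq (a *: u + v).
Proof.
by move=> /fq fu /fq fv; apply/fq; rewrite hq_lin fu fv scaler0 addr0.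
Qed.

Program Definition kernel_ideal : crossed_ideal X :=
  @CrossedIdeal X (subspace_of ker_n0 ker_nL) (subspace_of ker_q0 ker_qL)
    _ _ _ _ _ _ _.
Next Obligation.
by move=> u /subspace_ofP/fn fu; apply/subspace_ofP/fq; rewrite hd fu raddf0.
Qed.
Next Obligation.
move=> x y /subspace_ofP/fq fx; apply/subspace_ofP/fq.
by rewrite hq_hom fx (lin0 (lb_linl _)).
Qed.
Next Obligation.
move=> x y /subspace_ofP/fq fx; apply/subspace_ofP/fq.
by rewrite hq_hom fx (lin0 (lb_linr _)).
Qed.
Next Obligation.
move=> y u /subspace_ofP/fn fx; apply/subspace_ofP/fn.
by rewrite hal fx (lin0 (al_linr act _)).
Qed.
Next Obligation.
move=> y u /subspace_ofP/fn fx; apply/subspace_ofP/fn.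
by rewrite har fx (lin0 (ar_linl act _)).
Qed.
Next Obligation.
move=> y u /subspace_ofP/fq fx; apply/subspace_ofP/fn.
by rewrite hal fx (lin0 (al_linl act _)).
Qed.
Next Obligation.
move=> y u /subspace_ofP/fq fx; apply/subspace_ofP/fn.
by rewrite har fx (lin0 (ar_linr act _)).
Qed.
End KernelIdeal.

Lemma crossed_idealP X (Pn : xn X -> Prop) (Pq : xq X -> Prop) :
  (exists Y (f : xhom X Y), is_kernel f Pn Pq) <->
  (exists I : crossed_ideal X, (forall u, u \in cn I <-> Pn u) /\
                               (forall x, x \in cq I <-> Pq x)).
Proof.
split=> [[Y [f fP]]|[I [In Iq]]].
  by exists (kernel_ideal fP); split=> u; split=> [/subspace_ofP //|Pu]; apply/subspace_ofP.
exists (quo_xmod I), (quo_proj I); have [kn kq] := quo_projP I.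
by split=> u; [rewrite kn|rewrite kq].
Qed.

Lemma hom_commutator X Y (f : xhom X Y) (I J : crossed_ideal X)
    (I' J' : crossed_ideal Y) :
  ideal_sub I (preimage f I') -> ideal_sub J (preimage f J') ->
  ideal_sub (commutator I J) (preimage f (commutator I' J')).
Proof.
move=> [In Iq] [Jn Jq].
have {}In u : u \in cn I -> hn f u \in cn I' by move/In/subspace_ofP.
have {}Iq u : u \in cq I -> hq f u \in cq I' by move/Iq/subspace_ofP.
have {}Jn u : u \in cn J -> hn f u \in cn J' by move/Jn/subspace_ofP.
have {}Jq u : u \in cq J -> hq f u \in cq J' by move/Jq/subspace_ofP.
split=> w wS; apply/subspace_ofP; move: w wS; apply: span_of_min => w.
  case=> -[h] [t] [hh ht].
    have g := mem_gen_n (Iq _ hh) (Jn _ ht).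
    by case=> ->; rewrite ?hal ?har g.
  have g := mem_gen_n' (Jq _ hh) (In _ ht).
  by case=> ->; rewrite ?hal ?har g.
case=> h [t] [hh ht].
have g := mem_gen_q (Iq _ hh) (Jq _ ht).
by case=> ->; rewrite hq_hom g.
Qed.

Section QuoLift.
Variables (X Y : xmod) (I : crossed_ideal X) (f : xhom X Y).
Hypotheses (fn0 : forall u, u \in cn I -> hn f u = 0)
           (fq0 : forall x, x \in cq I -> hq f x = 0).

Definition quo_lift_n (u : xn (quo_xmod I)) : xn Y := hn f (quo_repr u).
Definition quo_lift_q (x : xq (quo_xmod I)) : xq Y := hq f (quo_repr x).

Lemma quo_lift_nE u : quo_lift_n (hn (quo_proj I) u) = hn f u.
Proof. by apply/eqP; rewrite -subr_eq0 -raddfB; apply/eqP/fn0/quo_repr_pi. Qed.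
Lemma quo_lift_qE x : quo_lift_q (hq (quo_proj I) x) = hq f x.
Proof. by apply/eqP; rewrite -subr_eq0 -raddfB; apply/eqP/fq0/quo_repr_pi. Qed.

Let pnK u : hn (quo_proj I) (quo_repr u) = u. Proof. exact: quo_reprK. Qed.
Let pqK x : hq (quo_proj I) (quo_repr x) = x. Proof. exact: quo_reprK. Qed.

Fact quo_lift_n_linear : linear quo_lift_n.
Proof.
move=> a u v; rewrite -[u]pnK -[v]pnK -hn_lin.
by rewrite !quo_lift_nE hn_lin.
Qed.
Fact quo_lift_q_linear : linear quo_lift_q.
Proof.
move=> a u v; rewrite -[u]pqK -[v]pqK -hq_lin.
by rewrite !quo_lift_qE hq_lin.
Qed.

Program Definition quo_lift : xhom (quo_xmod I) Y :=
  @XHom (quo_xmod I) Y (linear_of quo_lift_n_linear) (linear_of quo_lift_q_linear)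
    _ _ _ _ _.
Next Obligation.
move=> u v; rewrite !linear_ofE -[u]pnK -[v]pnK -(hn_hom (quo_proj I)).
by rewrite !quo_lift_nE hn_hom.
Qed.
Next Obligation.
move=> u v; rewrite !linear_ofE -[u]pqK -[v]pqK -(hq_hom (quo_proj I)).
by rewrite !quo_lift_qE hq_hom.
Qed.
Next Obligation.
move=> u; rewrite !linear_ofE -[u]pnK -[X in quo_lift_q X](hd (quo_proj I)).
by rewrite quo_lift_nE quo_lift_qE hd.
Qed.
Next Obligation.
move=> y u; rewrite !linear_ofE -[u]pnK -[y]pqK.
by rewrite -[X in quo_lift_n X](hal (quo_proj I)) !quo_lift_nE !quo_lift_qE hal.
Qed.
Next Obligation.
move=> u y; rewrite !linear_ofE -[u]pnK -[y]pqK.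
by rewrite -[X in quo_lift_n X](har (quo_proj I)) !quo_lift_nE !quo_lift_qE har.
Qed.

Lemma quo_liftP : eq_hom (hom_comp quo_lift (quo_proj I)) f.
Proof. by split=> u; [apply: quo_lift_nE|apply: quo_lift_qE]. Qed.
End QuoLift.

(* Factorization of [f] through an injective [i] whose image contains that of *)
(* [f].                                                                       *)
Section InjLift.
Variables (A X Y : xmod) (i : xhom A Y) (f : xhom X Y).
Hypotheses (inj_i : injective_hom i)
  (fn_im : forall u, exists a, hn i a = hn f u)
  (fq_im : forall x, exists b, hq i b = hq f x).

Definition inj_lift_n (u : xn X) : xn A := sval (cid (fn_im u)).
Definition inj_lift_q (x : xq X) : xq A := sval (cid (fq_im x)).
Lemma inj_lift_nE u : hn i (inj_lift_n u) = hn f u.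
Proof. by rewrite /inj_lift_n; case: cid. Qed.
Lemma inj_lift_qE x : hq i (inj_lift_q x) = hq f x.
Proof. by rewrite /inj_lift_q; case: cid. Qed.

Let inj_n := inj_i.1.
Let inj_q := inj_i.2.

Fact inj_lift_n_linear : linear inj_lift_n.
Proof. by move=> a u v; apply: inj_n; rewrite hn_lin !inj_lift_nE hn_lin. Qed.
Fact inj_lift_q_linear : linear inj_lift_q.
Proof. by move=> a u v; apply: inj_q; rewrite hq_lin !inj_lift_qE hq_lin. Qed.

Program Definition inj_lift : xhom X A :=
  @XHom X A (linear_of inj_lift_n_linear) (linear_of inj_lift_q_linear)
    _ _ _ _ _.
Next Obligation.
by move=> u v; rewrite !linear_ofE; apply: inj_n; rewrite hn_hom !inj_lift_nE hn_hom.
Qed.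
Next Obligation.
by move=> u v; rewrite !linear_ofE; apply: inj_q; rewrite hq_hom !inj_lift_qE hq_hom.
Qed.
Next Obligation.
by move=> u; rewrite !linear_ofE; apply: inj_q; rewrite hd inj_lift_qE inj_lift_nE hd.
Qed.
Next Obligation.
move=> y u; rewrite !linear_ofE; apply: inj_n.
by rewrite hal inj_lift_qE !inj_lift_nE hal.
Qed.
Next Obligation.
move=> y u; rewrite !linear_ofE; apply: inj_n.
by rewrite har inj_lift_qE !inj_lift_nE har.
Qed.

Lemma inj_liftP : eq_hom (hom_comp i inj_lift) f.
Proof. by split=> u; [apply: inj_lift_nE|apply: inj_lift_qE]. Qed.
End InjLift.

Definition derived X : crossed_ideal X :=
  commutator (full_ideal X) (full_ideal X).

Definition abelianization X : xmod := quo_xmod (derived X).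

Lemma hom_derived X Y (f : xhom X Y) : ideal_sub (derived X) (preimage f (derived Y)).
Proof. by apply: hom_commutator; split=> *; do 2!apply/subspace_ofP. Qed.

Fact abelianization_map_n X Y (f : xhom X Y) u :
  u \in cn (derived X) -> hn (hom_comp (quo_proj (derived Y)) f) u = 0.
Proof.
by move=> uX; apply/(quo_projP _).1; have /subspace_ofP := (hom_derived f).1 u uX.
Qed.
Fact abelianization_map_q X Y (f : xhom X Y) x :
  x \in cq (derived X) -> hq (hom_comp (quo_proj (derived Y)) f) x = 0.
Proof.
by move=> xX; apply/(quo_projP _).2; have /subspace_ofP := (hom_derived f).2 x xX.
Qed.

Definition abelianization_map X Y (f : xhom X Y) :
    xhom (abelianization X) (abelianization Y) :=
  quo_lift (@abelianization_map_n X Y f) (@abelianization_map_q X Y f).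

(* Short exact sequences 0 -> A -> H -> N -> 0. *)
Record extension (A H N : xmod) := Extension {
  ext_i : xhom A H;
  ext_p : xhom H N;
  ext_inj : injective_hom ext_i;
  ext_surj : surjective_hom ext_p;
  ext_exact : is_kernel ext_p (fun u => exists a, hn ext_i a = u)
                              (fun x => exists b, hq ext_i b = x) }.

(* A, viewed inside H as a crossed ideal: the image of A -> H. *)
Definition ext_ideal A H N (e : extension A H N) : crossed_ideal H :=
  kernel_ideal (ext_exact e).

Lemma ext_ideal_n A H N (e : extension A H N) u :
  u \in cn (ext_ideal e) <-> hn (ext_p e) u = 0.
Proof.
by split=> [/subspace_ofP/(ext_exact e).1 //|/(ext_exact e).1 ?]; apply/subspace_ofP.
Qed.
Lemma ext_ideal_q A H N (e : extension A H N) x :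
  x \in cq (ext_ideal e) <-> hq (ext_p e) x = 0.
Proof.
by split=> [/subspace_ofP/(ext_exact e).2 //|/(ext_exact e).2 ?]; apply/subspace_ofP.
Qed.

Definition central A H N (e : extension A H N) : Prop :=
  ideal_trivial (commutator (ext_ideal e) (full_ideal H)).

Definition stem A H N (e : extension A H N) : Prop :=
  central e /\ ideal_sub (ext_ideal e) (derived H).

Record projective_presentation (N : xmod) := ProjectivePresentation {
  pp_u : xmod;
  pp_m : xmod;
  pp_ext :> extension pp_u pp_m N;
  pp_projective : projective pp_m }.

Section SchurMultiplier.
Variables (N : xmod) (P : projective_presentation N).

(* (u, r, mu) /\ [(m, f, mu), (m, f, mu)] *)
Definition schur_num : crossed_ideal (pp_m P) :=
  ideal_cap (ext_ideal P) (derived (pp_m P)).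

(* [(u, r, mu), (m, f, mu)] *)
Definition schur_den : crossed_ideal (pp_m P) :=
  commutator (ext_ideal P) (full_ideal (pp_m P)).

Lemma schur_den_sub : ideal_sub schur_den schur_num.
Proof.
have F x : x \in cq (full_ideal (pp_m P)) by apply/subspace_ofP.
have G u : u \in cn (full_ideal (pp_m P)) by apply/subspace_ofP.
split=> u uS; apply/subspace_ofP; split; move: u uS.
- apply: (@span_of_min _ _ _ _ idfun) => w /=; case=> -[h] [t] [hh ht []->];
    solve [exact: (@cq_al _ (ext_ideal P))|exact: (@cq_ar _ (ext_ideal P))
          |exact: (@cn_al _ (ext_ideal P))|exact: (@cn_ar _ (ext_ideal P))].
- apply: (@span_of_min _ _ _ _ idfun) => w /=; case=> -[h] [t] [hh ht []->];
    have [? ?] := mem_gen_n (F h) (G t); assumption.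
- apply: (@span_of_min _ _ _ _ idfun) => w /= [h] [t] [hh ht []->];
    solve [exact: (@cq_lbl _ (ext_ideal P))|exact: (@cq_lbr _ (ext_ideal P))].
- apply: (@span_of_min _ _ _ _ idfun) => w /= [h] [t] [hh ht []->];
    have [? ?] := mem_gen_q (F h) (F t); assumption.
Qed.

Definition schur_multiplier : xmod :=
  quo_xmod (preimage (sub_incl schur_num) schur_den).

Definition schur_class : xhom (sub_xmod schur_num) schur_multiplier :=
  quo_proj (preimage (sub_incl schur_num) schur_den).

End SchurMultiplier.

Definition stem_cover A H N (e : extension A H N) (P : projective_presentation N) :
    Prop :=
  stem e /\ isomorphic A (schur_multiplier P).

(* [f] lifts (m, f, mu) -> (n, q, delta) along (h, p, sigma) -> (n, q, delta). *)
Definition is_lift A H N (e : extension A H N) (P : projective_presentation N)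
    (f : xhom (pp_m P) H) : Prop :=
  eq_hom (hom_comp (ext_p e) f) (ext_p P).

Arguments is_lift {A H N} e P f.

Lemma lift_exists A H N (e : extension A H N) (P : projective_presentation N) :
  exists f, is_lift e P f.
Proof. exact: (@pp_projective _ P _ _ (ext_p e) _ (ext_surj e)). Qed.

Section Theta.
Variables (A H N : xmod) (e : extension A H N) (e_central : central e).
Variables (P : projective_presentation N) (f : xhom (pp_m P) H).
Hypothesis f_lift : is_lift e P f.

Definition theta_pre : xhom (sub_xmod (schur_num P)) H :=
  hom_comp f (sub_incl (schur_num P)).

Fact theta_im_n u : exists a, hn (ext_i e) a = hn theta_pre u.
Proof.
apply/(ext_exact e).1; rewrite -[LHS]/(hn (hom_comp (ext_p e) f) (sub_val u)) f_lift.1.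
by have /subspace_ofP[/ext_ideal_n] := sub_valP u.
Qed.
Fact theta_im_q x : exists b, hq (ext_i e) b = hq theta_pre x.
Proof.
apply/(ext_exact e).2; rewrite -[LHS]/(hq (hom_comp (ext_p e) f) (sub_val x)) f_lift.2.
by have /subspace_ofP[/ext_ideal_q] := sub_valP x.
Qed.

(* The restriction of [f] to the numerator of the multiplier, as a            *)
(* homomorphism into A.                                                       *)
Definition theta_restr : xhom (sub_xmod (schur_num P)) A :=
  inj_lift (ext_inj e) theta_im_n theta_im_q.

Fact lift_den : ideal_sub (schur_den P)
  (preimage f (commutator (ext_ideal e) (full_ideal H))).
Proof.
apply: hom_commutator; split=> u uP; do 1?apply/subspace_ofP.
- apply/ext_ideal_n; rewrite -[LHS]/(hn (hom_comp (ext_p e) f) u) f_lift.1.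
  exact/ext_ideal_n.
- apply/ext_ideal_q; rewrite -[LHS]/(hq (hom_comp (ext_p e) f) u) f_lift.2.
  exact/ext_ideal_q.
- exact/subspace_ofP.
- exact/subspace_ofP.
Qed.

Fact theta_den_n u :
  u \in cn (preimage (sub_incl (schur_num P)) (schur_den P)) -> hn theta_restr u = 0.
Proof.
move=> /subspace_ofP/(lift_den.1)/subspace_ofP/(e_central.1) fu0.
by apply: (ext_inj e).1; rewrite raddf0 -fu0; apply: inj_lift_nE.
Qed.
Fact theta_den_q x :
  x \in cq (preimage (sub_incl (schur_num P)) (schur_den P)) -> hq theta_restr x = 0.
Proof.
move=> /subspace_ofP/(lift_den.2)/subspace_ofP/(e_central.2) fu0.
by apply: (ext_inj e).2; rewrite raddf0 -fu0; apply: inj_lift_qE.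
Qed.

(* theta_*(e), computed from the lift [f]; see [thetaP]. *)
Definition theta : xhom (schur_multiplier P) A := quo_lift theta_den_n theta_den_q.

Lemma thetaP :
  eq_hom (hom_comp (ext_i e) (hom_comp theta (schur_class P)))
         (hom_comp f (sub_incl (schur_num P))).
Proof.
split=> u.
  rewrite -[LHS]/(hn (ext_i e) (hn (hom_comp theta (schur_class P)) u)).
  by rewrite (quo_liftP theta_den_n theta_den_q).1; apply: inj_lift_nE.
rewrite -[LHS]/(hq (ext_i e) (hq (hom_comp theta (schur_class P)) u)).
by rewrite (quo_liftP theta_den_n theta_den_q).2; apply: inj_lift_qE.
Qed.
End Theta.

(* [g] is a morphism of presentations over [phi]. *)
Definition lifts_over H N (phi : xhom H N) (Q : projective_presentation H)
    (P : projective_presentation N) (g : xhom (pp_m Q) (pp_m P)) : Prop :=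
  eq_hom (hom_comp (ext_p P) g) (hom_comp phi (ext_p Q)).

Arguments lifts_over {H N} phi Q P g.

Lemma lifts_over_exists H N (phi : xhom H N) (Q : projective_presentation H)
    (P : projective_presentation N) : exists g, lifts_over phi Q P g.
Proof. exact: (@pp_projective _ Q _ _ (ext_p P) _ (ext_surj P)). Qed.

Section SchurMap.
Variables (H N : xmod) (phi : xhom H N) (Q : projective_presentation H)
  (P : projective_presentation N) (g : xhom (pp_m Q) (pp_m P)).
Hypothesis g_over : lifts_over phi Q P g.

Fact g_kernel : ideal_sub (ext_ideal Q) (preimage g (ext_ideal P)).
Proof.
split=> u uQ; apply/subspace_ofP.
- apply/ext_ideal_n; rewrite -[LHS]/(hn (hom_comp (ext_p P) g) u) g_over.1.
  by rewrite -[LHS]/(hn phi (hn (ext_p Q) u)) (ext_ideal_n Q u).1 ?hn0.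
- apply/ext_ideal_q; rewrite -[LHS]/(hq (hom_comp (ext_p P) g) u) g_over.2.
  by rewrite -[LHS]/(hq phi (hq (ext_p Q) u)) (ext_ideal_q Q u).1 ?hq0.
Qed.

Fact sub_incl_inj X (I : crossed_ideal X) : injective_hom (sub_incl I).
Proof. by split=> u v; apply: sub_eq. Qed.

Let schur_pre := hom_comp g (sub_incl (schur_num Q)).

Fact schur_im_n u : exists a, hn (sub_incl (schur_num P)) a = hn schur_pre u.
Proof.
have /subspace_ofP[uQ uD] := sub_valP u.
suff gu : hn schur_pre u \in cn (schur_num P) by exists (SubOf gu).
apply/subspace_ofP; split.
  by have /subspace_ofP := g_kernel.1 _ uQ.
by have /subspace_ofP := (hom_derived g).1 _ uD.
Qed.
Fact schur_im_q x : exists b, hq (sub_incl (schur_num P)) b = hq schur_pre x.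
Proof.
have /subspace_ofP[uQ uD] := sub_valP x.
suff gu : hq schur_pre x \in cq (schur_num P) by exists (SubOf gu).
apply/subspace_ofP; split.
  by have /subspace_ofP := g_kernel.2 _ uQ.
by have /subspace_ofP := (hom_derived g).2 _ uD.
Qed.

Definition schur_restr : xhom (sub_xmod (schur_num Q)) (sub_xmod (schur_num P)) :=
  inj_lift (@sub_incl_inj _ (schur_num P)) schur_im_n schur_im_q.

Fact g_den : ideal_sub (schur_den Q) (preimage g (schur_den P)).
Proof.
apply: hom_commutator; first exact: g_kernel.
by split=> u _; do 2!apply/subspace_ofP.
Qed.

Let schur_to := hom_comp (schur_class P) schur_restr.

Fact schur_map_n u :
  u \in cn (preimage (sub_incl (schur_num Q)) (schur_den Q)) -> hn schur_to u = 0.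
Proof.
move=> /subspace_ofP/(g_den.1)/subspace_ofP gu.
apply/(quo_projP _).1/subspace_ofP.
by rewrite -[hn schur_restr u]/(inj_lift_n schur_im_n u) inj_lift_nE.
Qed.
Fact schur_map_q x :
  x \in cq (preimage (sub_incl (schur_num Q)) (schur_den Q)) -> hq schur_to x = 0.
Proof.
move=> /subspace_ofP/(g_den.2)/subspace_ofP gu.
apply/(quo_projP _).2/subspace_ofP.
by rewrite -[hq schur_restr x]/(inj_lift_q schur_im_q x) inj_lift_qE.
Qed.

(* The homomorphism of Schur multipliers induced by [phi]. *)
Definition schur_map : xhom (schur_multiplier Q) (schur_multiplier P) :=
  quo_lift schur_map_n schur_map_q.
End SchurMap.

End CrossedModules.

Arguments is_lift {K A H N} e P f.
Arguments lifts_over {K H N} phi Q P g.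

(* Main.v *)
Require Import Defs.
From mathcomp Require Import all_boot ssralg.

(** Everything rests on how a homomorphism sees commutators modulo an ideal [J]
    of its target [Y]: the bracket and the two actions are bilinear, so changing
    their arguments by elements of [J] changes their values by elements of
    [[J, Y]].  Two consequences carry the proof.
    - If [f : X -> Y] is surjective modulo [J], then [[Y, Y]] is the image of
      [[X, X]] modulo [[J, Y]] ([derived_mod_image]).
    - If [a, b : X -> Y] agree modulo [J], then on [[X, X]] they agree modulo
      [[J, Y]] ([hom_congr_derived]).
    Both become exact statements when [J] is central.

    Write [0 -> U -> F -> N -> 0] for the presentation of [N] and
    [0 -> V -> G -> H -> 0] for that of [H].  The lift [f : F -> H] is surjective
    modulo the central ideal [A], hence [[H, H] = f [F, F]]; an element of [A] in
    [[H, H]] is then [f u] with [u] in the intersection of [U] and [[F, F]],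
    which is to say that a stem extension has a surjective [theta].  The other
    implications of the first cycle compare [A], which is the kernel of
    [H -> N], with [[H, H]].

    For the second cycle, a surjective [theta] onto an object isomorphic to the
    finite-dimensional multiplier is a surjective endomorphism up to
    isomorphism, hence injective.  It remains to see that [theta] is injective if
    and only if [M(H) -> M(N)] is zero, which is the exactness of
    [M(H) -> M(N) -> A].
    - The composite [M(H) -> M(N) -> A] vanishes, because [f \o g] and the
      projection of [G] both lift [G -> N] and so agree on [[G, G]]; hence
      [M(H) -> M(N)] is zero when [theta] is injective
      ([schur_map_zero_of_theta_inj]).
    - If [f u = 0], lift [f] through [G] to [k : F -> G].  Then [k u] represents
      a class of [M(H)], and [g (k u)] is congruent to [u] modulo [[U, F]]
      because [g \o k] is the identity modulo [U]; so the class of [u] comes from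
      [M(H)] ([theta_inj_of_schur_map_zero]). *)

Set Implicit Arguments.
Unset Strict Implicit.
Unset Printing Implicit Defensive.

Import GRing.Theory.
Local Open Scope ring_scope.

(** * Linear algebra *)

Lemma bilinearBB (K : fieldType) (U V W : lmodType K) (m : U -> V -> W) :
    (forall v, linear (m^~ v)) -> (forall u, linear (m u)) ->
  forall x y x' y', m x y - m x' y' = m (x - x') y + m x' (y - y').
Proof.
by move=> ml mr x y x' y'; rewrite (linB (ml _)) (linB (mr _)) addrA subrK.
Qed.

(** Induction on the size of a spanning family [b].  A nonzero [v] in the kernel
    gives a linear relation between the [s (b i)], so that one of them is
    redundant; the others still span [V] because [s] is surjective, and they form
    a shorter family. *)
Lemma surj_endo_fin_dim_inj (K : fieldType) (V : lmodType K)
    (s : {linear V -> V}) :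
  finite_dimensional V -> (forall v, exists u, s u = v) -> injective s.
Proof.
move=> [n [b gen_b]] s_surj; apply: raddf_inj => v.
elim: n => [|n IHn] in b gen_b v *.
  by have [c ->] := gen_b v; rewrite big_ord0.
have [c def_v] := gen_b v => sv0.
have [j cj_neq0|c_eq0] := pickP (fun j => c j != 0); last first.
  by rewrite def_v big1 // => i _; move/eqP: (c_eq0 i) => ->; rewrite scale0r.
have s_bj : s (b j) = \sum_(i < n) (- ((c j)^-1 * c (lift j i))) *: s (b (lift j i)).
  have : s ((c j)^-1 *: v) = 0 by rewrite linearZ /= sv0 scaler0.
  rewrite def_v scaler_sumr linear_sum /= (bigD1_ord j) //= scalerA mulVf //.
  rewrite scale1r => /eqP; rewrite addr_eq0 => /eqP ->.
  by rewrite -sumrN; apply: eq_bigr => i _; rewrite scalerA linearZ scaleNr.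
apply: (IHn (fun i => s (b (lift j i)))) sv0 => w.
have [u <-] := s_surj w; have [d ->] := gen_b u.
exists (fun i => d j * (- ((c j)^-1 * c (lift j i))) + d (lift j i)).
rewrite linear_sum /= (bigD1_ord j) //= linearZ /= s_bj scaler_sumr -big_split.
by apply: eq_bigr => i _; rewrite [s (_ *: _)]linearZ /= scalerA -scalerDl.
Qed.

Section CrossedModules.
Variable K : fieldType.
Implicit Types A H N X Y Z : xmod K.

(** * Homomorphisms and commutators *)

Program Definition id_hom X : xhom X X := @XHom K X X idfun idfun _ _ _ _ _.
Solve All Obligations with by [].

(** The inverse is the factorization of the identity of [Y] through [f]. *)
Lemma isomorphismP X Y (f : xhom X Y) :
  isomorphism f <-> injective_hom f /\ surjective_hom f.
Proof.
split=> [[g [fgn gfn fgq gfq]]|[f_inj [fn_surj fq_surj]]].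
  split; first by split; [apply: can_inj fgn | apply: can_inj fgq].
  by split=> v; [exists (hn g v) | exists (hq g v)].
pose g := inj_lift f_inj (f := id_hom Y) fn_surj fq_surj.
have gn : cancel (hn g) (hn f) := (inj_liftP f_inj (f := id_hom Y) fn_surj fq_surj).1.
have gq : cancel (hq g) (hq f) := (inj_liftP f_inj (f := id_hom Y) fn_surj fq_surj).2.
by exists g; split=> // u; [apply: f_inj.1; rewrite gn | apply: f_inj.2; rewrite gq].
Qed.

Lemma surj_endo_fin_dim_xmod_inj X (s : xhom X X) :
  finite_dimensional_xmod X -> surjective_hom s -> injective_hom s.
Proof.
by move=> [fdn fdq] [sn sq]; split; apply: surj_endo_fin_dim_inj.
Qed.

Lemma full_n X u : u \in cn (full_ideal X). Proof. exact/subspace_ofP. Qed.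
Lemma full_q X x : x \in cq (full_ideal X). Proof. exact/subspace_ofP. Qed.

Lemma quo_proj_surj X (I : crossed_ideal X) : surjective_hom (quo_proj I).
Proof. by split=> u; exists (quo_repr u); apply: quo_reprK. Qed.

Section CongruenceModulo.
Variables (Y : xmod K) (J : crossed_ideal Y).
Let JY := commutator J (full_ideal Y).
Let act := x_act Y.

Lemma commutator_alB x x' u u' : x - x' \in cq J -> u - u' \in cn J ->
  xal x u - xal x' u' \in cn JY.
Proof.
move=> Jx Ju; rewrite (bilinearBB (al_linl act) (al_linr act)).
by rewrite rpredD ?(mem_gen_n Jx (full_n _)) ?(mem_gen_n' (full_q _) Ju).
Qed.

Lemma commutator_arB x x' u u' : x - x' \in cq J -> u - u' \in cn J ->
  xar u x - xar u' x' \in cn JY.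
Proof.
move=> Jx Ju; rewrite (bilinearBB (ar_linl act) (ar_linr act)).
by rewrite rpredD ?(mem_gen_n Jx (full_n _)) ?(mem_gen_n' (full_q _) Ju).
Qed.

Lemma commutator_lbB x x' y y' : x - x' \in cq J -> y - y' \in cq J ->
  lb x y - lb x' y' \in cq JY.
Proof.
move=> Jx Jy; rewrite (bilinearBB (@lb_linl _ _) (@lb_linr _ _)).
by rewrite rpredD ?(mem_gen_q Jx (full_q _)) ?(mem_gen_q Jy (full_q _)).
Qed.

(** The difference of the two homomorphisms is linear, so it is enough to look at
    the generators of the derived ideal. *)
Lemma hom_congr_derived X (a b : xhom X Y) :
    (forall u, hn a u - hn b u \in cn J) ->
    (forall x, hq a x - hq b x \in cq J) ->
  (forall w, w \in cn (derived X) -> hn a w - hn b w \in cn JY) /\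
  (forall z, z \in cq (derived X) -> hq a z - hq b z \in cq JY).
Proof.
move=> Jn Jq; split.
  apply: (@span_of_min _ _ _ _ (hn a \- hn b)) => w.
  by case=> -[h] [t] [_ _ []->] /=; rewrite ?hal ?har;
    [apply: commutator_alB | apply: commutator_arB
    |apply: commutator_alB | apply: commutator_arB].
apply: (@span_of_min _ _ _ _ (hq a \- hq b)) => w [x] [y] [_ _ []->] /=;
  by rewrite !hq_hom; apply: commutator_lbB.
Qed.

(** Approximating both entries of a generator of the derived ideal of [Y] by
    images under [f] moves the generator by an element of [[J, Y]]. *)
Lemma derived_mod_image X (f : xhom X Y) :
    (forall u, exists v, u - hn f v \in cn J) ->
    (forall x, exists y, x - hq f y \in cq J) ->
  (forall w, w \in cn (derived Y) ->
    exists2 v, v \in cn (derived X) & w - hn f v \in cn JY) /\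
  (forall z, z \in cq (derived Y) ->
    exists2 y, y \in cq (derived X) & z - hq f y \in cq JY).
Proof.
move=> fn fq; split=> w /subspace_ofP; elim=> {w} [w|| c w1 w2 _ [v1 D1 J1] _ [v2 D2 J2]].
- have [D_al D_ar] : (forall y u, xal y u \in cn (derived X)) /\
                     (forall y u, xar u y \in cn (derived X)).
    by split=> y u; rewrite (mem_gen_n (full_q y) (full_n u)).
  case=> -[h] [t] [_ _ gen_w]; have [[y Jy] [v Jv]] := (fq h, fn t);
    case: gen_w => ->; [exists (xal y v) | exists (xar v y)
                       |exists (xal y v) | exists (xar v y)] => //;
    by rewrite ?hal ?har; apply: commutator_alB || apply: commutator_arB.
- by exists 0; rewrite ?hn0 ?subrr rpred0.
- exists (c *: v1 + v2); first by rewrite rpredD ?rpredZ.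
  by rewrite hn_lin opprD addrACA -scalerBr rpredD ?rpredZ.
- have D_lb x y : lb x y \in cq (derived X).
    by rewrite (mem_gen_q (full_q x) (full_q y)).
  case=> x [y] [_ _ gen_w]; have [[x' Jx] [y' Jy]] := (fq x, fq y).
  by case: gen_w => ->; [exists (lb x' y') | exists (lb y' x')] => //;
    rewrite hq_hom; apply: commutator_lbB.
- by exists 0; rewrite ?hq0 ?subrr rpred0.
- exists (c *: v1 + v2); first by rewrite rpredD ?rpredZ.
  by rewrite hq_lin opprD addrACA -scalerBr rpredD ?rpredZ.
Qed.


(** A homomorphism that is onto modulo a central ideal is onto on derived
    ideals. *)
Lemma derived_image X (f : xhom X Y) : ideal_trivial JY ->
    (forall u, exists v, u - hn f v \in cn J) ->
    (forall x, exists y, x - hq f y \in cq J) ->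
  (forall w, w \in cn (derived Y) -> exists2 v, v \in cn (derived X) & hn f v = w) /\
  (forall z, z \in cq (derived Y) -> exists2 y, y \in cq (derived X) & hq f y = z).
Proof.
move=> [JYn JYq] fn fq; have [Dn Dq] := derived_mod_image fn fq.
split=> w Dw; [have [v Dv Jv] := Dn w Dw | have [v Dv Jv] := Dq w Dw]; exists v => //.
  exact/esym/subr0_eq/JYn.
exact/esym/subr0_eq/JYq.
Qed.
End CongruenceModulo.

Lemma commutator_subl X (I J : crossed_ideal X) : ideal_sub (commutator I J) I.
Proof.
split; apply: (@span_of_min _ _ _ _ idfun) => w /=.
  by case=> -[h] [t] [hI tJ []->];
    [apply: cq_al | apply: cq_ar | apply: cn_al | apply: cn_ar].
by case=> x [y] [xI yJ []->]; [apply: cq_lbl | apply: cq_lbr].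
Qed.

Lemma surj_derived X Y (p : xhom X Y) : surjective_hom p ->
  (forall w, w \in cn (derived Y) -> exists2 v, v \in cn (derived X) & hn p v = w) /\
  (forall z, z \in cq (derived Y) -> exists2 y, y \in cq (derived X) & hq p y = z).
Proof.
move=> [pn pq].
(* The zero ideal of [Y] is encoded as the kernel of the identity. *)
have ker_id : is_kernel (id_hom Y) (fun u => u = 0) (fun x => x = 0) by [].
apply: (@derived_image _ (kernel_ideal ker_id)).
- by have [In Iq] := commutator_subl (kernel_ideal ker_id) (full_ideal Y);
    split=> u => [/In|/Iq] /subspace_ofP.
- by move=> u; have [v <-] := pn u; exists v; rewrite subrr rpred0.
- by move=> x; have [y <-] := pq x; exists y; rewrite subrr rpred0.
Qed.

(** The only obstruction is injectivity.  An element of [X] whose image lies in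
    the derived ideal of [Y] differs from an element of the derived ideal of [X]
    by an element of the kernel, because [p] is onto on derived ideals. *)
Lemma abelianization_map_iso X Y (p : xhom X Y) : surjective_hom p ->
  (isomorphism (abelianization_map p) <->
   (forall u, hn p u = 0 -> u \in cn (derived X)) /\
   (forall x, hq p x = 0 -> x \in cq (derived X))).
Proof.
move=> p_surj; have [Dn Dq] := surj_derived p_surj.
have [kXn kXq] := quo_projP (derived X); have [kYn kYq] := quo_projP (derived Y).
have [sXn sXq] := quo_proj_surj (derived X).
have [sYn sYq] := quo_proj_surj (derived Y).
have [abn abq] : eq_hom (hom_comp (abelianization_map p) (quo_proj (derived X)))
                        (hom_comp (quo_proj (derived Y)) p).
  exact: quo_liftP.
rewrite isomorphismP; split=> [[[inj_n inj_q] _]|[kn kq]].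
  split=> u pu0; [apply/kXn/inj_n | apply/kXq/inj_q].
    by rewrite hn0; exact: etrans (abn u) (etrans (congr1 _ pu0) (hn0 _)).
  by rewrite hq0; exact: etrans (abq u) (etrans (congr1 _ pu0) (hq0 _)).
split; split.
- apply: raddf_inj => v; have [u <-] := sXn v => abu0; apply/kXn.
  have /kYn/Dn[d Dd pd] : hn (quo_proj (derived Y)) (hn p u) = 0.
    exact: etrans (esym (abn u)) abu0.
  by rewrite -(subrK d u) rpredD // kn // (linB (hn_lin p)) pd subrr.
- apply: raddf_inj => v; have [u <-] := sXq v => abu0; apply/kXq.
  have /kYq/Dq[d Dd pd] : hq (quo_proj (derived Y)) (hq p u) = 0.
    exact: etrans (esym (abq u)) abu0.
  by rewrite -(subrK d u) rpredD // kq // (linB (hq_lin p)) pd subrr.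
- move=> v; have [w <-] := sYn v; have [u <-] := p_surj.1 w.
  by exists (hn (quo_proj (derived X)) u); apply: abn.
- move=> v; have [w <-] := sYq v; have [u <-] := p_surj.2 w.
  by exists (hq (quo_proj (derived X)) u); apply: abq.
Qed.

(** * Central extensions and Schur multipliers *)

Section Theta.
Variables (A H N : xmod K) (e : extension A H N) (e_central : central e).
Variables (P : projective_presentation N) (f : xhom (pp_m P) H).
Hypothesis f_lift : is_lift e P f.
Let theta := theta e_central f_lift.

Let thetaE_n u : hn (ext_i e) (hn theta (hn (schur_class P) u)) = hn f (sub_val u).
Proof. exact: (thetaP e_central f_lift).1. Qed.
Let thetaE_q x : hq (ext_i e) (hq theta (hq (schur_class P) x)) = hq f (sub_val x).
Proof. exact: (thetaP e_central f_lift).2. Qed.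
Let class_n : forall v, exists u, hn (schur_class P) u = v.
Proof. exact: (quo_proj_surj _).1. Qed.
Let class_q : forall v, exists u, hq (schur_class P) u = v.
Proof. exact: (quo_proj_surj _).2. Qed.

(** This criterion and the next two trade homomorphisms out of a multiplier,
    a quotient of a subobject, for conditions on elements of the projective
    middle terms. *)
Lemma theta_surjP : surjective_hom theta <->
  (forall a, exists2 u, u \in cn (schur_num P) & hn f u = hn (ext_i e) a) /\
  (forall b, exists2 x, x \in cq (schur_num P) & hq f x = hq (ext_i e) b).
Proof.
split=> -[Sn Sq]; split=> a.
- have [v <-] := Sn a; have [u <-] := class_n v.
  by exists (sub_val u); rewrite ?thetaE_n ?sub_valP.
- have [v <-] := Sq a; have [u <-] := class_q v.
  by exists (sub_val u); rewrite ?thetaE_q ?sub_valP.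
- have [u Mu fu] := Sn a; exists (hn (schur_class P) (SubOf Mu)).
  by apply: (ext_inj e).1; rewrite thetaE_n.
- have [u Mu fu] := Sq a; exists (hq (schur_class P) (SubOf Mu)).
  by apply: (ext_inj e).2; rewrite thetaE_q.
Qed.

Lemma theta_injP : injective_hom theta <->
  (forall u, u \in cn (schur_num P) -> hn f u = 0 -> u \in cn (schur_den P)) /\
  (forall x, x \in cq (schur_num P) -> hq f x = 0 -> x \in cq (schur_den P)).
Proof.
have [kn kq] := quo_projP (preimage (sub_incl (schur_num P)) (schur_den P)).
split=> [[In Iq]|[In Iq]].
  split=> u Mu fu0.
    suff /kn/subspace_ofP : hn (schur_class P) (SubOf Mu) = 0 by [].
    by apply: In; apply: (ext_inj e).1; rewrite thetaE_n !hn0.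
  suff /kq/subspace_ofP : hq (schur_class P) (SubOf Mu) = 0 by [].
  by apply: Iq; apply: (ext_inj e).2; rewrite thetaE_q !hq0.
split; apply: raddf_inj => v.
  have [u <-] := class_n v => tu0; apply/kn/subspace_ofP/In; first exact: sub_valP.
  by rewrite -thetaE_n tu0 hn0.
have [u <-] := class_q v => tu0; apply/kq/subspace_ofP/Iq; first exact: sub_valP.
by rewrite -thetaE_q tu0 hq0.
Qed.
End Theta.

Lemma schur_map_zeroP H N (phi : xhom H N) (Q : projective_presentation H)
    (P : projective_presentation N) (g : xhom (pp_m Q) (pp_m P))
    (g_over : lifts_over phi Q P g) :
  zero_hom (schur_map g_over) <->
  (forall u, u \in cn (schur_num Q) -> hn g u \in cn (schur_den P)) /\
  (forall x, x \in cq (schur_num Q) -> hq g x \in cq (schur_den P)).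
Proof.
have [kn kq] := quo_projP (preimage (sub_incl (schur_num P)) (schur_den P)).
have [mn mq] : eq_hom (hom_comp (schur_map g_over) (schur_class Q))
                      (hom_comp (schur_class P) (schur_restr g_over)).
  exact: quo_liftP.
have rn u : sub_val (hn (schur_restr g_over) u) = hn g (sub_val u).
  exact: (inj_lift_nE (schur_im_n g_over) u).
have rq x : sub_val (hq (schur_restr g_over) x) = hq g (sub_val x).
  exact: (inj_lift_qE (schur_im_q g_over) x).
split=> -[zn zq]; split=> u.
- move=> Mu; rewrite -[u]/(sub_val (SubOf Mu)) -rn.
  have /kn/subspace_ofP : hn (schur_class P) (hn (schur_restr g_over) (SubOf Mu)) = 0.
    exact: etrans (esym (mn _)) (zn _).
  by [].
- move=> Mu; rewrite -[u]/(sub_val (SubOf Mu)) -rq.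
  have /kq/subspace_ofP : hq (schur_class P) (hq (schur_restr g_over) (SubOf Mu)) = 0.
    exact: etrans (esym (mq _)) (zq _).
  by [].
- have [v <-] := (quo_proj_surj (preimage (sub_incl (schur_num Q)) (schur_den Q))).1 u.
  apply: etrans (mn v) _; apply/kn/subspace_ofP.
  by have := zn _ (sub_valP v); rewrite -rn.
- have [v <-] := (quo_proj_surj (preimage (sub_incl (schur_num Q)) (schur_den Q))).2 u.
  apply: etrans (mq v) _; apply/kq/subspace_ofP.
  by have := zq _ (sub_valP v); rewrite -rq.
Qed.

Section CentralExtension.
Variables (A H N : xmod K) (e : extension A H N) (e_central : central e).
Variables (P : projective_presentation N) (f : xhom (pp_m P) H).
Hypothesis f_lift : is_lift e P f.

Let fPn v : hn (ext_p e) (hn f v) = hn (ext_p P) v := f_lift.1 v.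
Let fPq y : hq (ext_p e) (hq f y) = hq (ext_p P) y := f_lift.2 y.

(** The lift [f] is onto modulo the central ideal [A], so every element of
    [[H, H]] is [f v] with [v] in [[F, F]]; if it lies in [A], then [v] lies in
    [U] because [f] is a map over [N]. *)
Lemma stem_theta_surj : stem e -> surjective_hom (theta e_central f_lift).
Proof.
move=> [_ [An Aq]]; apply/theta_surjP.
have [||Dn Dq] := @derived_image _ (ext_ideal e) _ f e_central.
- move=> u; have [v pv] := (ext_surj P).1 (hn (ext_p e) u); exists v.
  by apply/ext_ideal_n; rewrite (linB (hn_lin _)) fPn pv subrr.
- move=> x; have [y py] := (ext_surj P).2 (hq (ext_p e) x); exists y.
  by apply/ext_ideal_q; rewrite (linB (hq_lin _)) fPq py subrr.
split=> a.
  have Aa : hn (ext_i e) a \in cn (ext_ideal e) by apply/subspace_ofP; exists a.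
  have [v Dv fv] := Dn _ (An _ Aa); exists v => //.
  by apply/subspace_ofP; split=> //; apply/ext_ideal_n; rewrite -fPn fv; apply/ext_ideal_n.
have Aa : hq (ext_i e) a \in cq (ext_ideal e) by apply/subspace_ofP; exists a.
have [y Dy fy] := Dq _ (Aq _ Aa); exists y => //.
by apply/subspace_ofP; split=> //; apply/ext_ideal_q; rewrite -fPq fy; apply/ext_ideal_q.
Qed.

Lemma theta_surj_abelianization_zero :
  surjective_hom (theta e_central f_lift) ->
  zero_hom (hom_comp (quo_proj (derived H)) (ext_i e)).
Proof.
have [kn kq] := quo_projP (derived H); move=> /theta_surjP[Sn Sq]; split=> a.
  apply/kn; have [u /subspace_ofP[_ Du] <-] := Sn a.
  by have /subspace_ofP := (hom_derived f).1 u Du.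
apply/kq; have [x /subspace_ofP[_ Dx] <-] := Sq a.
by have /subspace_ofP := (hom_derived f).2 x Dx.
Qed.

Lemma abelianization_zero_iso :
  zero_hom (hom_comp (quo_proj (derived H)) (ext_i e)) ->
  isomorphism (abelianization_map (ext_p e)).
Proof.
have [kn kq] := quo_projP (derived H) => -[zn zq].
apply/(abelianization_map_iso (ext_surj e)).
by split=> u; [move/(ext_exact e).1 | move/(ext_exact e).2] => -[a <-];
  [apply/kn/zn | apply/kq/zq].
Qed.

Lemma abelianization_iso_stem :
  isomorphism (abelianization_map (ext_p e)) -> stem e.
Proof.
move=> /(abelianization_map_iso (ext_surj e))[Dn Dq]; split=> //.
by split=> u; [move/ext_ideal_n/Dn | move/ext_ideal_q/Dq].
Qed.

(** Composing [theta] with the isomorphism from [A] gives a surjective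
    endomorphism of the finite-dimensional multiplier. *)
Lemma isomorphic_theta_inj :
    finite_dimensional_xmod (schur_multiplier P) ->
    isomorphic A (schur_multiplier P) ->
  surjective_hom (theta e_central f_lift) ->
  injective_hom (theta e_central f_lift).
Proof.
move=> fdM [s /isomorphismP[_ [sn sq]]]; set t := theta _ _ => t_surj.
have [st_n st_q] : injective_hom (hom_comp s t).
  apply: surj_endo_fin_dim_xmod_inj => //; split=> v.
    by have [a <-] := sn v; have [u <-] := t_surj.1 a; exists u.
  by have [a <-] := sq v; have [u <-] := t_surj.2 a; exists u.
by split; [apply: inj_compr st_n | apply: inj_compr st_q].
Qed.

Section InducedMap.
Variables (Q : projective_presentation H) (g : xhom (pp_m Q) (pp_m P)).
Hypothesis g_over : lifts_over (ext_p e) Q P g.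

Let gQn u : hn (ext_p P) (hn g u) = hn (ext_p e) (hn (ext_p Q) u) := g_over.1 u.
Let gQq x : hq (ext_p P) (hq g x) = hq (ext_p e) (hq (ext_p Q) x) := g_over.2 x.

(** Both [f \o g] and [ext_p Q] lift the same map to [N], so they agree modulo
    the central [A], hence exactly on [[G, G]].  As [ext_p Q] kills the numerator
    of [M(H)], so does [f \o g]. *)
Lemma schur_map_zero_of_theta_inj :
  injective_hom (theta e_central f_lift) -> zero_hom (schur_map g_over).
Proof.
move=> /theta_injP[In Iq]; apply/schur_map_zeroP.
have [||Cn Cq] := @hom_congr_derived _ (ext_ideal e) _ (hom_comp f g) (ext_p Q).
- by move=> u; apply/ext_ideal_n; rewrite (linB (hn_lin _)) /= fPn gQn subrr.
- by move=> x; apply/ext_ideal_q; rewrite (linB (hq_lin _)) /= fPq gQq subrr.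
split=> u /subspace_ofP[Ku Du].
  apply: In; last first.
    by have /e_central.1/subr0_eq/= -> := Cn u Du; apply/ext_ideal_n.
  apply/subspace_ofP; split; last by have /subspace_ofP := (hom_derived g).1 u Du.
  by have /subspace_ofP := (g_kernel g_over).1 u Ku.
apply: Iq; last first.
  by have /e_central.2/subr0_eq/= -> := Cq u Du; apply/ext_ideal_q.
apply/subspace_ofP; split; last by have /subspace_ofP := (hom_derived g).2 u Du.
by have /subspace_ofP := (g_kernel g_over).2 u Ku.
Qed.

(** A lift [k : F -> G] of [f] turns an element of the kernel of [f] into an
    element of the kernel of [ext_p Q], and on [[F, F]] applying [g] brings it
    back, modulo the denominator of [M(N)]. *)
Lemma theta_inj_of_schur_map_zero :
  zero_hom (schur_map g_over) -> injective_hom (theta e_central f_lift).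
Proof.
move=> /schur_map_zeroP[zn zq].
have [k k_lift] := @pp_projective _ _ P _ _ (ext_p Q) f (ext_surj Q).
have kn v : hn (ext_p Q) (hn k v) = hn f v := k_lift.1 v.
have kq y : hq (ext_p Q) (hq k y) = hq f y := k_lift.2 y.
(* [g \o k] is an endomorphism of the presentation over [N]. *)
have [||Cn Cq] := @hom_congr_derived _ (ext_ideal P) _ (id_hom _) (hom_comp g k).
- by move=> v; apply/ext_ideal_n; rewrite (linB (hn_lin _)) /= gQn kn fPn subrr.
- by move=> y; apply/ext_ideal_q; rewrite (linB (hq_lin _)) /= gQq kq fPq subrr.
apply/theta_injP; split=> u /subspace_ofP[_ Du] fu0.
  rewrite -(subrK (hn g (hn k u)) u) rpredD //; first exact: Cn.
  apply: zn; apply/subspace_ofP; split; first by apply/ext_ideal_n; rewrite kn.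
  by have /subspace_ofP := (hom_derived k).1 u Du.
rewrite -(subrK (hq g (hq k u)) u) rpredD //; first exact: Cq.
apply: zq; apply/subspace_ofP; split; first by apply/ext_ideal_q; rewrite kq.
by have /subspace_ofP := (hom_derived k).2 u Du.
Qed.
End InducedMap.
End CentralExtension.
End CrossedModules.

Theorem proposition4p2 (K : fieldType) (A H N : xmod K) (e : extension A H N)
    (e_central : central e) (P : projective_presentation N)
    (f : xhom (pp_m P) H) (f_lift : is_lift e P f) :
  [<-> stem e;
       surjective_hom (theta e_central f_lift);
       zero_hom (hom_comp (quo_proj (derived H)) (ext_i e));
       isomorphism (abelianization_map (ext_p e))]
  /\
  (finite_dimensional_xmod (schur_multiplier P) ->
   forall (Q : projective_presentation H) (g : xhom (pp_m Q) (pp_m P))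
     (g_over : lifts_over (ext_p e) Q P g),
   [<-> stem_cover e P;
        isomorphism (theta e_central f_lift);
        isomorphism (abelianization_map (ext_p e)) /\
          zero_hom (schur_map g_over)]).
Proof.
have part_i : [<-> stem e;
       surjective_hom (theta e_central f_lift);
       zero_hom (hom_comp (quo_proj (derived H)) (ext_i e));
       isomorphism (abelianization_map (ext_p e))].
  tfae; [exact: stem_theta_surj | exact: theta_surj_abelianization_zero
        |exact: abelianization_zero_iso | exact: abelianization_iso_stem].
split=> [|fdM Q g g_over]; first exact: part_i.
have surj_iso : surjective_hom (theta e_central f_lift) <->
                isomorphism (abelianization_map (ext_p e)) := part_i 1%N 3%N.
tfae.
- move=> [/(stem_theta_surj e_central f_lift) t_surj A_iso_M].
  by apply/isomorphismP; split=> //; apply: isomorphic_theta_inj.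
- move=> /isomorphismP[t_inj t_surj]; split; first exact/surj_iso.
  exact: schur_map_zero_of_theta_inj t_inj.
- move=> [ab_iso /(theta_inj_of_schur_map_zero e_central f_lift) t_inj].
  split; first exact: abelianization_iso_stem.
  have t_surj := surj_iso.2 ab_iso.
  have /isomorphismP[t [? ? ? ?]] := conj t_inj t_surj.
  by exists t, (theta e_central f_lift).
Qed.
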